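(* Let $m\in\mathbb{N}$, let $E_1,\dots,E_m$ be Banach spaces over $\mathbb{K}$, and let $\mathcal{E}$ be a quasi-Banach standard sequence space over a Banach space $X$. Let $\mathbf{r},\mathbf{s},\mathbf{t},\mathbf{u}\in[1,+\infty)^m$ and let $\Lambda\subset\Gamma\subset\mathbb{N}^m$ be (non-empty) sets of indexes. Then $$\Pi_{(\mathbf{r},\mathbf{s})}^{\Lambda}(E_1,\ldots,E_m;\mathcal{E})\setminus\Pi_{(\mathbf{t},\mathbf{u})}^{\Gamma}(E_1,\ldots,E_m;\mathcal{E})$$ is either empty or pointwise $\mathfrak{c}$-spaceable (as a subset of the quasi-Banach space $\Pi_{(\mathbf{r},\mathbf{s})}^{\Lambda}(E_1,\ldots,E_m;\mathcal{E})$).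
   Context: $\mathbb{K}$ is $\mathbb{R}$ or $\mathbb{C}$; $\mathfrak{c}=\mathrm{card}\,\mathbb{R}$; $\mathbb{N}=\{1,2,3,\dots\}$. $E'$ is the topological dual of $E$ and $B_{E'}$ its closed unit ball. A quasi-norm is a map $\|\cdot\|\ge 0$ on a vector space with $\|x\|=0$ only if $x=0$, $\|\lambda x\|=|\lambda|\|x\|$ and $\|x+y\|\le C(\|x\|+\|y\|)$ for some constant $C\ge1$; a quasi-Banach space is a complete quasi-normed space. Every quasi-Banach space is assumed, after passing to an equivalent quasi-norm (Aoki-Rolewicz), to be $p$-Banach for some $0<p\le1$, i.e. $\|x+y\|^p\le\|x\|^p+\|y\|^p$. Quasi-Banach standard sequence space over a Banach space $X$: an infinite-dimensional quasi-Banach space $\mathcal{E}$ whose elements are $X$-valued sequences, with the usual operations, such that: (i) there is $C>0$ with $\|x_j\|_X\le C\|x\|_{\mathcal{E}}$ for all $x=(x_j)_j\in\mathcal{E}$ and $j\in\mathbb{N}$; (ii) if $x=(x_j)_j\in\mathcal{E}$ and $(x_{n_k})_k$ is a subsequence of $x$, then $(x_{n_k})_k\in\mathcal{E}$ and $\|(x_{n_k})_k\|_{\mathcal{E}}\le\|x\|_{\mathcal{E}}$; (iii) if $x=(x_j)_j\in\mathcal{E}$ and $\{n_1<n_2<\cdots\}$ is an infinite subset of $\mathbb{N}$, then the sequence $y$ given by $y_j=x_i$ if $j=n_i$ and $y_j=0$ otherwise belongs to $\mathcal{E}$ and $\|y\|_{\mathcal{E}}\le\|x\|_{\mathcal{E}}$.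 Mixed norms: for a quasi-Banach space $F$, $\mathbf{r}=(r_1,\dots,r_m)\in[1,\infty)^m$ and $(x_{\mathbf{i}})_{\mathbf{i}\in\mathbb{N}^m}\subset F$, with $\mathbf{i}=(i_1,\dots,i_m)$, $$\|(x_{\mathbf{i}})_{\mathbf{i}\in\mathbb{N}^m}\|_{\ell_{\mathbf{r}}(F)}=\Big(\sum_{i_1=1}^\infty\Big(\cdots\Big(\sum_{i_m=1}^\infty\|x_{\mathbf{i}}\|_F^{r_m}\Big)^{\frac{r_{m-1}}{r_m}}\cdots\Big)^{\frac{r_1}{r_2}}\Big)^{\frac1{r_1}},$$ and for non-empty $\Lambda\subset\mathbb{N}^m$, $\|(x_{\mathbf{i}})_{\mathbf{i}\in\Lambda}\|_{\ell_{\mathbf{r}}(F)}$ is the norm of the multi-matrix that equals $x_{\mathbf{i}}$ on $\Lambda$ and $0$ off $\Lambda$. $\Lambda$-summing operators: an $m$-linear operator $T:E_1\times\cdots\times E_m\to F$ is $\Lambda$-$(\mathbf{r};\mathbf{s})$-summing if there is $C>0$ such that $$\|(Tx_{\mathbf{i}})_{\mathbf{i}\in\Lambda}\|_{\ell_{\mathbf{r}}(F)}\le C\prod_{k=1}^m\sup_{\phi_k\in B_{E_k'}}\Big(\sum_{i=1}^N|\phi_k(x_i^{(k)})|^{s_k}\Big)^{1/s_k}$$ for all $N\in\mathbb{N}$ and $x_i^{(k)}\in E_k$, $k=1,\dots,m$, $i=1,\dots,N$, where $Tx_{\mathbf{i}}:=T(x_{i_1}^{(1)},\dots,x_{i_m}^{(m)})$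 (with $x_i^{(k)}=0$ for $i>N$). $\Pi^{\Lambda}_{(\mathbf{r},\mathbf{s})}(E_1,\dots,E_m;F)$ is the class of all such operators, a quasi-Banach space under $\pi^{\Lambda}_{(\mathbf{r};\mathbf{s})}(T)$, the infimum of the admissible constants $C$. Pointwise spaceability: for a cardinal $\alpha\le\dim V$, a subset $A$ of a topological vector space $V$ is pointwise $\alpha$-spaceable if for each $x\in A$ there is a closed linear subspace $W\subset V$ with $\dim W=\alpha$ and $x\in W\subset A\cup\{0\}$. *)

(* Defs.v *)
From HB Require Import structures.
From mathcomp Require Import all_boot all_order all_algebra.
From mathcomp Require Import complex.
From mathcomp Require Import all_classical all_reals all_analysis.

Set Implicit Arguments.
Unset Strict Implicit.
Unset Printing Implicit Defensive.
Import Order.TTheory GRing.Theory Num.Theory.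
Import numFieldNormedType.Exports.
Local Open Scope classical_set_scope.
Local Open Scope card_scope.
Local Open Scope ring_scope.

(* Indices start from 0: {1, 2, ...} is identified with nat by the shift
   n |-> n.-1, so the points x_1, ..., x_N become x_0, ..., x_(N-1). *)

Inductive scalar_kind := RealScalars | ComplexScalars.

Definition scalars (R : realType) (k : scalar_kind) : numFieldType :=
  match k with
  | RealScalars => R
  | ComplexScalars => R[i]
  end.

Definition scalar_re (R : realType) (k : scalar_kind) : scalars R k -> R :=
  match k return scalars R k -> R with
  | RealScalars => fun a => a
  | ComplexScalars => fun a => complex.Re a
  end.

(* Norms of the library are K-valued; for K = R[i] they are nonnegative reals
   seen in R[i], and taking the real part loses nothing. *)
Definition nrm (R : realType) (k : scalar_kind)
    (V : normedModType (scalars R k)) (x : V) : R := scalar_re `|x|.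

Definition sabs (R : realType) (k : scalar_kind) (a : scalars R k) : R :=
  scalar_re `|a|.

(** Linear dimension *)

Definition lin_indep (K : fieldType) (L : lmodType K) (B : set L) : Prop :=
  forall (n : nat) (v : 'I_n -> L) (c : 'I_n -> K),
    injective v -> (forall i, B (v i)) ->
    \sum_(i < n) c i *: v i = 0 -> forall i, c i = 0.

Definition lin_span (K : fieldType) (L : lmodType K) (B : set L) : set L :=
  [set x | exists (n : nat) (v : 'I_n -> L) (c : 'I_n -> K),
     (forall i, B (v i)) /\ x = \sum_(i < n) c i *: v i].

Definition hamel_basis (K : fieldType) (L : lmodType K) (V B : set L) : Prop :=
  lin_indep B /\ lin_span B = V.

(* Cardinals are represented by sets: alpha stands for its own cardinality. *)
Definition has_dim (K : fieldType) (L : lmodType K) (V : set L)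
    (S : Type) (alpha : set S) : Prop :=
  exists2 B : set L, hamel_basis V B & B #= alpha.

Definition card_le_dim (K : fieldType) (L : lmodType K) (V : set L)
    (S : Type) (alpha : set S) : Prop :=
  exists2 B : set L, hamel_basis V B & alpha #<= B.

Definition infinite_dim (K : fieldType) (L : lmodType K) (V : set L) : Prop :=
  ~ exists2 B : set L, hamel_basis V B & finite_set B.

(** Quasi-Banach spaces: a quasi-normed space is given by a linear subspace V
    of an ambient vector space L and a function q : L -> R of which only the
    values on V matter. *)

Definition quasi_norm (R : realType) (k : scalar_kind)
    (L : lmodType (scalars R k)) (V : set L) (q : L -> R) : Prop :=
  [/\ forall x, V x -> 0 <= q x,
      forall x, V x -> q x = 0 -> x = 0,
      forall a x, V x -> q (a *: x) = sabs a * q x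
    & exists2 C : R, 1 <= C &
        forall x y, V x -> V y -> q (x + y) <= C * (q x + q y)].

Definition p_subadditive (R : realType) (L : zmodType) (V : set L)
    (q : L -> R) (p : R) : Prop :=
  forall x y, V x -> V y -> q (x + y) `^ p <= q x `^ p + q y `^ p.

Definition quasi_complete (R : realType) (L : zmodType) (V : set L)
    (q : L -> R) : Prop :=
  forall u : nat -> L, (forall n, V (u n)) ->
    (forall e : R, 0 < e -> exists n0 : nat, forall i j : nat,
       (n0 <= i)%N -> (n0 <= j)%N -> q (u i - u j) < e) ->
    exists2 l : L, V l &
      forall e : R, 0 < e -> exists n0 : nat, forall i : nat,
        (n0 <= i)%N -> q (u i - l) < e.

(* The p-subadditivity is the standing (Aoki-Rolewicz) normalization. *)
Definition quasi_banach (R : realType) (k : scalar_kind)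
    (L : lmodType (scalars R k)) (V : set L) (q : L -> R) : Prop :=
  [/\ GRing.submod_closed [in V],
      quasi_norm V q,
      quasi_complete V q
    & exists2 p : R, 0 < p <= 1 & p_subadditive V q p].

(* Topology on V induced by the quasi-norm q. Quasi-norm balls need not be
   open, but they are neighborhoods of their centers. *)
Definition quasi_open (R : realType) (L : zmodType) (V : set L) (q : L -> R)
    (U : set L) : Prop :=
  U `<=` V /\ forall x, U x ->
    exists2 e : R, 0 < e & forall y, V y -> q (y - x) < e -> U y.

Definition quasi_closed (R : realType) (L : zmodType) (V : set L) (q : L -> R)
    (W : set L) : Prop :=
  W `<=` V /\ quasi_open V q (V `\` W).

Definition pointwise_spaceable (R : realType) (k : scalar_kind)
    (L : lmodType (scalars R k)) (V : set L) (q : L -> R)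
    (S : Type) (alpha : set S) (A : set L) : Prop :=
  [/\ card_le_dim V alpha,
      A `<=` V
    & forall x, A x -> exists W : set L,
        [/\ GRing.submod_closed [in W], quasi_closed V q W, has_dim W alpha,
            W x & W `<=` A `|` [set 0]]].

(** Sequence spaces *)

Definition standard_sequence_space (R : realType) (k : scalar_kind)
    (X : completeNormedModType (scalars R k))
    (V : set (nat -> X)) (q : (nat -> X) -> R) : Prop :=
  [/\ quasi_banach V q,
      infinite_dim V,
      exists2 C : R, 0 < C &
        forall x, V x -> forall j, nrm (x j) <= C * q x,
      forall (x : nat -> X) (n : nat -> nat), V x ->
        {homo n : i j / (i < j)%N} -> V (x \o n) /\ q (x \o n) <= q x
    & forall (x y : nat -> X) (n : nat -> nat), V x ->
        {homo n : i j / (i < j)%N} ->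
        (forall i, y (n i) = x i) -> (forall j, ~ range n j -> y j = 0) ->
        V y /\ q y <= q x].

(** Mixed norms *)

(* (sum_(i_1) (... (sum_(i_m) (a i)^(r_m))^(r_(m-1)/r_m) ...)^(r_1/r_2))^(e/r_1),
   where i ranges over m-tuples; the exponent e is the r_(j-1) handed down to
   the next level of the recursion. *)
Fixpoint mixed_sum (R : realType) (e : R) (m : nat) :
    m.-tuple R -> (m.-tuple nat -> \bar R) -> \bar R :=
  match m return m.-tuple R -> (m.-tuple nat -> \bar R) -> \bar R with
  | 0 => fun _ a => (a [tuple] `^ e)%E
  | m'.+1 => fun r a =>
      ((\sum_(0 <= i <oo)
          mixed_sum (thead r) [tuple of behead r]
            (fun t : m'.-tuple nat => a [tuple of i :: t]))
         `^ (e / thead r))%E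
  end.

Definition mixed_norm (R : realType) (L : Type) (q : L -> R) (m : nat)
    (r : m.-tuple R) (x : m.-tuple nat -> L) : \bar R :=
  mixed_sum 1 r (fun i => (q (x i))%:E).

Definition mixed_norm_on (R : realType) (L : zmodType) (q : L -> R) (m : nat)
    (Lambda : set (m.-tuple nat)) (r : m.-tuple R)
    (x : m.-tuple nat -> L) : \bar R :=
  mixed_norm q r (patch (fun=> 0) Lambda x).

(** Weak norms: the suprema below are over nonempty bounded sets. *)

Definition dual_norm (R : realType) (k : scalar_kind)
    (E : normedModType (scalars R k)) (phi : E -> scalars R k) : R :=
  sup [set sabs (phi x) | x in [set x : E | nrm x <= 1]].

Definition dual_ball (R : realType) (k : scalar_kind)
    (E : normedModType (scalars R k)) : set {linear E -> (scalars R k)^o} :=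
  [set phi : {linear E -> (scalars R k)^o} |
     continuous phi /\ dual_norm phi <= 1].

Arguments dual_ball {R k} E.

Definition weak_norm (R : realType) (k : scalar_kind)
    (E : normedModType (scalars R k)) (s : R) (N : nat) (x : nat -> E) : R :=
  sup [set (\sum_(i < N) sabs (phi (x i)) `^ s) `^ s^-1 | phi in dual_ball E].

(** Summing operators *)

Definition multilinear (K : fieldType) (m : nat) (E : 'I_m -> lmodType K)
    (L : lmodType K) (T : (forall j, E j) -> L) : Prop :=
  forall (x : forall j, E j) (j : 'I_m) (a : K) (u v : E j),
    T (dfwith x j (a *: u + v)) = a *: T (dfwith x j u) + T (dfwith x j v).

Definition summing_const (R : realType) (k : scalar_kind) (m : nat)
    (E : 'I_m -> completeNormedModType (scalars R k))
    (L : lmodType (scalars R k)) (q : L -> R)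
    (Lambda : set (m.-tuple nat)) (r s : m.-tuple R)
    (T : (forall j, E j) -> L) (C : R) : Prop :=
  0 < C /\
  forall (N : nat) (x : forall j, nat -> E j), (0 < N)%N ->
    (forall j i, (N <= i)%N -> x j i = 0) ->
    (mixed_norm_on q Lambda r (fun i => T (fun j => x j (tnth i j)))
      <= (C * \prod_(j < m) weak_norm (tnth s j) N (x j))%:E)%E.

(* The class of Lambda-(r;s)-summing m-linear operators from the E j into the
   space (V, q). *)
Definition summing (R : realType) (k : scalar_kind) (m : nat)
    (E : 'I_m -> completeNormedModType (scalars R k))
    (L : lmodType (scalars R k)) (V : set L) (q : L -> R)
    (Lambda : set (m.-tuple nat)) (r s : m.-tuple R) :
    set ((forall j, E j) -> L) :=
  [set T | [/\ forall x, V (T x), multilinear T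
             & exists C, summing_const q Lambda r s T C]].

Arguments summing {R k m} E {L} V q Lambda r s.

Definition summing_norm (R : realType) (k : scalar_kind) (m : nat)
    (E : 'I_m -> completeNormedModType (scalars R k))
    (L : lmodType (scalars R k)) (q : L -> R)
    (Lambda : set (m.-tuple nat)) (r s : m.-tuple R)
    (T : (forall j, E j) -> L) : R :=
  inf [set C | summing_const q Lambda r s T C].

(* Main.v *)
Require Import Defs.
From HB Require Import structures.
From mathcomp Require Import all_boot all_order all_algebra.
From mathcomp Require Import complex lra.
From mathcomp Require Import all_classical all_reals all_analysis.

Set Implicit Arguments.
Unset Strict Implicit.
Unset Printing Implicit Defensive.
Import Order.TTheory GRing.Theory Num.Theory.
Import numFieldNormedType.Exports.
Local Open Scope classical_set_scope.
Local Open Scope ring_scope.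
Local Open Scope card_scope.

(* Let T be Lambda-summing but not Gamma-summing. T is the sum of its parts
   with values supported on even and on odd positions, so one of the two parts,
   say the one on the set M of positions of parity eps, is not Gamma-summing.
   Split the complement of M in infinitely many infinite sets N_0, N_1, ... and
   let T_c be T with its values stretched along N_c. The space W of all
   Lambda-summing operators b_0 T + sum_c b_(c+1) T_c, the sum being taken
   coordinatewise, contains T. If such an operator is Gamma-summing then so are
   its restriction b_0 T|M to M and, once b_0 = 0, its subsequence b_(c+1) T
   along N_c, so all b_i vanish. If T(x0) is nonzero at a position of M, its
   copies read off the b_i one after the other; hence W is closed, because the
   scalars are complete. W embeds in K^nat, and the series sum_c lam^c T_c, with
   lam ranging over an interval, are linearly independent members of W. *)

(** * Cardinality of the continuum *)

Lemma injective_card_le (T U : Type) (A : set T) (B : set U) (f : T -> U) :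
  injective f -> (forall x, A x -> B (f x)) -> A #<= B.
Proof.
move=> finj AB.
have : f @` A #= A by apply: inj_card_eq => x y _ _; apply: finj.
rewrite card_eq_le => /andP[_ /card_le_trans]; apply.
by apply: subset_card_le => _ [x Ax <-]; apply: AB.
Qed.

(** Partial sums of the Cantor-type series $\sum_{i \in A} 3^{-i}$. In base 3 the tail after a
    position weighs at most half of that position, which separates distinct sets. *)
Definition ternary_sum (R : realType) (A : set nat) (n : nat) : R :=
  \sum_(i < n) (val i \in A)%:R * 3%:R ^- i.

Lemma ternary_sumS (R : realType) (A : set nat) (n : nat) :
  ternary_sum R A n.+1 = ternary_sum R A n + (n \in A)%:R * 3%:R ^- n.
Proof. by rewrite /ternary_sum big_ord_recr. Qed.

(** The added term is the full tail $\sum_{i \ge n} 3^{-i}$. From one index to the next it drops by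
    exactly $3^{-n}$, and the partial sum grows by at most that. *)
Lemma ternary_sum_tail (R : realType) (A : set nat) (n k : nat) :
  ternary_sum R A (n + k)%N + 3%:R / 2%:R * 3%:R ^- (n + k)
    <= ternary_sum R A n + 3%:R / 2%:R * 3%:R ^- n.
Proof.
elim: k => [|k IHk]; first by rewrite addn0.
apply: le_trans IHk; rewrite addnS ternary_sumS exprS invfM.
have : 0 < (3%:R : R) ^- (n + k) by rewrite invr_gt0 exprn_gt0.
by case: (_ \in A) => /= ?; lra.
Qed.

Lemma ternary_sum_nd (R : realType) (A : set nat) (n k : nat) :
  ternary_sum R A n <= ternary_sum R A (n + k).
Proof.
elim: k => [|k IHk]; first by rewrite addn0.
by apply: le_trans IHk _; rewrite addnS ternary_sumS lerDl mulr_ge0.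
Qed.

Lemma ternary_sum_le (R : realType) (A : set nat) (n N : nat) :
  ternary_sum R A N <= ternary_sum R A n + 3%:R / 2%:R * 3%:R ^- n.
Proof.
have pos j : 0 < (3%:R : R) ^- j by rewrite invr_gt0 exprn_gt0.
have [leNn|/ltnW lenN] := leqP N n.
  rewrite -(subnKC leNn); apply: le_trans (ternary_sum_nd _ _ _ (n - N)) _.
  by have := pos (N + (n - N))%N; lra.
rewrite -(subnKC lenN); apply: le_trans (ternary_sum_tail _ _ _ (N - n)).
by have := pos (n + (N - n))%N; lra.
Qed.

Definition ternary_real (R : realType) (A : set nat) : R :=
  sup (range (ternary_sum R A)).

(** At [n] the set [A] gains $3^{-n}$, while all that [B] can collect beyond [n] is at most half of
    that. *)
Lemma ternary_real_lt (R : realType) (A B : set nat) (n : nat) :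
  (forall i, (i < n)%N -> A i <-> B i) -> A n -> ~ B n ->
  ternary_real R B < ternary_real R A.
Proof.
move=> AB An Bn; have pos j : 0 < (3%:R : R) ^- j by rewrite invr_gt0 exprn_gt0.
have eq_n : ternary_sum R A n = ternary_sum R B n.
  apply: eq_bigr => i _; congr ((nat_of_bool _)%:R * _); apply/idP/idP;
    by move=> /set_mem/(AB _ (ltn_ord i))/mem_set.
have leB : ternary_real R B <= ternary_sum R B n.+1 + 3%:R / 2%:R * 3%:R ^- n.+1.
  apply: ge_sup; first by exists (ternary_sum R B 0), 0%N.
  by move=> _ [N _ <-]; apply: ternary_sum_le.
have leA : ternary_sum R A n.+1 <= ternary_real R A.
  apply: ub_le_sup; last by exists n.+1.
  exists (ternary_sum R A 0 + 3%:R / 2%:R * 3%:R ^- 0).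
  by move=> _ [N _ <-]; apply: ternary_sum_le.
apply: le_lt_trans leB (lt_le_trans _ leA).
rewrite !ternary_sumS eq_n exprS invfM (mem_set An) (memNset Bn) /=.
by have := pos n; lra.
Qed.

Lemma ternary_real_inj (R : realType) : injective (ternary_real R).
Proof.
move=> A B AB; apply: contrapT => /eqP neqAB.
have [n0 n0P] : exists n, (n \in A) != (n \in B).
  apply: contrapT => /forallNP eqAB; case/eqP: neqAB; apply/seteqP.
  by split=> i /mem_set; have /negP/negPn/eqP := eqAB i;
    [move=> ->|move=> <-] => /set_mem.
have [n nP nmin] := find_ex_minn (ex_intro (fun n => (n \in A) != (n \in B)) n0 n0P).
have below i : (i < n)%N -> A i <-> B i.
  move=> ltin; have : ~~ ((i \in A) != (i \in B)).
    by apply/negP => /nmin; rewrite leqNgt ltin.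
  by move/negPn/eqP => eqi; split=> /mem_set; [rewrite eqi|rewrite -eqi] => /set_mem.
have [An|An] := boolP (n \in A); have [Bn|Bn] := boolP (n \in B);
  rewrite ?An ?Bn ?(negbTE An) ?(negbTE Bn) // in nP.
  have := @ternary_real_lt R A B n below (set_mem An) (negP Bn \o mem_set).
  by rewrite AB ltxx.
have := @ternary_real_lt R B A n (fun i lti => iff_sym (below i lti))
  (set_mem Bn) (negP An \o mem_set).
by rewrite AB ltxx.
Qed.

Lemma power_set_card_le (R : realType) (T : countType) :
  [set: set T] #<= [set: R].
Proof.
apply: (@injective_card_le _ _ _ _
  (fun A : set T => ternary_real R (pickle @` A))) => //.
move=> A B /ternary_real_inj AB; apply/seteqP; split=> x Ax.
  have : (pickle @` A) (pickle x) by exists x.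
  by rewrite AB => -[y By /(pcan_inj pickleK) <-].
have : (pickle @` B) (pickle x) by exists x.
by rewrite -AB => -[y By /(pcan_inj pickleK) <-].
Qed.

Lemma cut_inj (R : realType) : injective (fun x : R => [set a : rat | ratr a < x]).
Proof.
move=> x y /seteqP[xy yx]; apply/eqP; rewrite eq_le !leNgt.
by apply/andP; split; apply/negP => /rat_in_itvoo[a];
  rewrite in_itv /= => /andP[ya ax]; [have := xy _ ax | have := yx _ ax];
  rewrite /= ltNge (ltW ya).
Qed.

Definition scalar_im (R : realType) (k : scalar_kind) : scalars R k -> R :=
  match k return scalars R k -> R with
  | RealScalars => fun=> 0
  | ComplexScalars => fun a => complex.Im a
  end.

Lemma scalar_re_im_inj (R : realType) (k : scalar_kind) (a b : scalars R k) :
  scalar_re a = scalar_re b -> scalar_im a = scalar_im b -> a = b.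
Proof. by case: k a b => //= -[? ?] [? ?] /= -> ->. Qed.

(** A sequence is coded by the rational cuts of the real and imaginary parts of its terms, that is,
    by a subset of a countable type. This bounds the dimension of W from above. *)
Lemma scalar_seq_card_le (R : realType) (k : scalar_kind) :
  [set: nat -> scalars R k] #<= [set: R].
Proof.
apply: card_le_trans (@power_set_card_le R (nat * bool * rat)%type).
pose part (c : bool) := if c then @scalar_re R k else @scalar_im R k.
apply: (@injective_card_le _ _ _ _
  (fun b => [set w : nat * bool * rat | ratr w.2 < part w.1.2 (b w.1.1)])) => //.
move=> b b' /seteqP[bb' b'b]; apply/funext => i.
have eq_part c : part c (b i) = part c (b' i).
  apply: cut_inj; apply/seteqP; split=> a /= ?.
    exact: (bb' (i, c, a)).
  exact: (b'b (i, c, a)).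
by apply: scalar_re_im_inj; [apply: (eq_part true) | apply: (eq_part false)].
Qed.

(** * Mixed sums *)

Lemma ge0_poweR_le (R : realType) (e : R) (x y : \bar R) :
  0 <= e -> (0 <= x)%E -> (x <= y)%E -> (x `^ e <= y `^ e)%E.
Proof.
move=> e0 x0 xy; apply: (gt0_ler_poweR e0) => //; rewrite in_itv /= leey andbT //.
exact: le_trans xy.
Qed.

(** Since [y + z] is at most twice the maximum, whose power is one of the two powers, a single
    argument covers exponents on both sides of 1. *)
Lemma poweR_le_quasi (R : realType) (e kap : R) (x y z : \bar R) :
  0 <= e -> 0 <= kap -> (0 <= x)%E -> (0 <= y)%E -> (0 <= z)%E ->
  (x <= kap%:E * (y + z))%E ->
  (x `^ e <= ((kap * 2) `^ e)%:E * (y `^ e + z `^ e))%E.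
Proof.
move=> e0 kap0 x0 y0 z0 xyz.
have max0 : (0 <= maxe y z)%E by rewrite le_max y0.
have k20 : (0 <= (kap * 2)%:E)%E by rewrite lee_fin mulr_ge0.
have le_max2 : (x <= (kap * 2)%:E * maxe y z)%E.
  apply: le_trans xyz _; rewrite EFinM -muleA; apply: lee_wpmul2l => //.
  by rewrite mule_natl mule2n leeD // le_max lexx ?orbT.
apply: le_trans (ge0_poweR_le e0 x0 le_max2) _.
rewrite poweRM // poweR_EFin; apply: lee_wpmul2l; first by rewrite lee_fin powR_ge0.
have [_|_] := leP y z; first by rewrite leeDr ?poweR_ge0.
by rewrite leeDl ?poweR_ge0.
Qed.

Lemma mixed_sum_ge0 (R : realType) (m : nat) (e : R) (r : m.-tuple R)
    (a : m.-tuple nat -> \bar R) : (0 <= mixed_sum e r a)%E.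
Proof. by case: m r a => [|m] r a; apply: poweR_ge0. Qed.

Lemma behead_tuple_ge1 (R : realType) (m : nat) (r : m.+1.-tuple R) :
  (forall j, 1 <= tnth r j) -> forall j, 1 <= tnth [tuple of behead r] j.
Proof. by move=> r1 j; rewrite tnth_behead. Qed.

(** A quasi-triangle inequality in place of Minkowski's: each level of the recursion only worsens
    the constant, which is chosen before the families [a], [b], [c]. *)
Lemma mixed_sum_le_quasi (R : realType) (m : nat) (r : m.-tuple R) (e kap : R) :
  (forall j, 1 <= tnth r j) -> 0 <= e -> 0 <= kap ->
  exists2 K : R, 0 <= K & forall a b c : m.-tuple nat -> \bar R,
    (forall i, 0 <= a i)%E -> (forall i, 0 <= b i)%E -> (forall i, 0 <= c i)%E ->
    (forall i, a i <= kap%:E * (b i + c i))%E ->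
    (mixed_sum e r a <= K%:E * (mixed_sum e r b + mixed_sum e r c))%E.
Proof.
elim: m r e => [|m IHm] r e r1 e0 kap0.
  exists ((kap * 2) `^ e); first exact: powR_ge0.
  by move=> a b c a0 b0 c0 abc; apply: poweR_le_quasi.
have rh1 : 1 <= thead r by apply: r1.
have rh0 : 0 <= thead r by apply: le_trans rh1.
have [K K0 IH] := IHm _ _ (behead_tuple_ge1 r1) rh0 kap0.
exists ((K * 2) `^ (e / thead r)); first exact: powR_ge0.
move=> a b c a0 b0 c0 abc /=.
have ge0 (f : m.+1.-tuple nat -> \bar R) : (0 <= \sum_(0 <= i <oo)
    mixed_sum (thead r) [tuple of behead r] (fun t => f [tuple of i :: t]))%E.
  by apply: nneseries_ge0 => n _ _; apply: mixed_sum_ge0.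
apply: poweR_le_quasi => //; first by rewrite divr_ge0.
rewrite -nneseriesD; [|by move=> *; apply: mixed_sum_ge0..].
rewrite -nneseriesZl; last by move=> *; rewrite adde_ge0 ?mixed_sum_ge0.
apply: lee_nneseries => [i _ _|i _]; first exact: mixed_sum_ge0.
by apply: IH => *.
Qed.

(** At each level all terms but one are dropped from the series. *)
Lemma mixed_sum_ge_entry (R : realType) (m : nat) (r : m.-tuple R) (e : R)
    (a : m.-tuple nat -> \bar R) (i : m.-tuple nat) :
  (forall j, 1 <= tnth r j) -> 0 <= e -> (forall i, 0 <= a i)%E ->
  (a i `^ e <= mixed_sum e r a)%E.
Proof.
elim: m r e a i => [|m IHm] r e a i r1 e0 a0; first by rewrite (tuple0 i).
have rh1 : 1 <= thead r by apply: r1.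
have rh0 : 0 < thead r by apply: lt_le_trans rh1.
case/tupleP: i => i0 i /=.
(* The exponent is factored so that the outer power [e / thead r] can be stripped by monotonicity,
   leaving [thead r] to the induction hypothesis. *)
have -> : e = thead r * (e / thead r) by rewrite mulrC divfK // gt_eqF.
rewrite poweRrM (mulrC (thead r)) divfK ?gt_eqF //.
have ge0 n : (0 <= mixed_sum (thead r) [tuple of behead r]
    (fun t => a [tuple of n :: t]))%E by apply: mixed_sum_ge0.
apply: ge0_poweR_le; rewrite ?poweR_ge0 ?divr_ge0 ?(ltW rh0) //.
have IH := IHm _ _ (fun t => a [tuple of i0 :: t]) i (behead_tuple_ge1 r1).
apply: le_trans (IH _ (ltW rh0) _) _ => //.
rewrite (@nneseriesD1 _ _ i0) // leeDl //.
by apply: nneseries_ge0 => *.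
Qed.

Lemma mixed_sum0 (R : realType) (m : nat) (r : m.-tuple R) (e : R) :
  (forall j, 1 <= tnth r j) -> 0 < e -> mixed_sum e r (fun=> 0%E) = 0%E.
Proof.
elim: m r e => [|m IHm] r e r1 e0 /=.
  by rewrite powR0 // gt_eqF.
have rh0 : 0 < thead r by apply: lt_le_trans (r1 ord0).
rewrite eseries0 => [|i _ _]; last by rewrite IHm //; apply: behead_tuple_ge1.
by rewrite poweR0r // gt_eqF // divr_gt0.
Qed.

(** * Scalars and norms *)

Definition of_real (R : realType) (k : scalar_kind) : R -> scalars R k :=
  match k return R -> scalars R k with
  | RealScalars => id
  | ComplexScalars => fun x => x%:C%C
  end.

Lemma of_real_inj (R : realType) (k : scalar_kind) :
  injective (of_real (R := R) k).
Proof. by case: k => [|] x y //= []. Qed.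

Lemma of_realX (R : realType) (k : scalar_kind) (x : R) n :
  of_real k (x ^+ n) = of_real k x ^+ n.
Proof. by case: k => //=; rewrite -rmorphXn. Qed.

Lemma scalar_reD (R : realType) (k : scalar_kind) (z w : scalars R k) :
  scalar_re (z + w) = scalar_re z + scalar_re w.
Proof. by case: k z w => //= -[? ?] [? ?]. Qed.

Lemma scalar_re_le (R : realType) (k : scalar_kind) (z w : scalars R k) :
  z <= w -> scalar_re z <= scalar_re w.
Proof. by case: k z w => //= z w; rewrite lecE => /andP[]. Qed.

Lemma scalar_re0 (R : realType) (k : scalar_kind) :
  scalar_re (0 : scalars R k) = 0.
Proof. by case: k. Qed.

(** In the order of [R[i]], nonnegativity includes the vanishing of the imaginary part. *)
Lemma ge0_of_real (R : realType) (k : scalar_kind) (z : scalars R k) :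
  0 <= z -> z = of_real k (scalar_re z).
Proof.
by case: k z => //= -[x y]; rewrite lecE => /andP[/= /eqP -> _].
Qed.

Lemma scalar_re_of_realM (R : realType) (k : scalar_kind) (x : R)
    (z : scalars R k) : scalar_re (of_real k x * z) = x * scalar_re z.
Proof. by case: k z => //= -[? ?] /=; rewrite mul0r subr0. Qed.

Lemma of_real_gt0 (R : realType) (k : scalar_kind) (x : R) :
  0 < x -> 0 < of_real k x.
Proof. by case: k => //= x0; rewrite ltcE /= eqxx. Qed.

Lemma of_real_lt (R : realType) (k : scalar_kind) (x y : R) :
  (of_real k x < of_real k y) = (x < y).
Proof. by case: k => //=; rewrite ltcE /= eqxx. Qed.

Lemma scalar_re_gt0 (R : realType) (k : scalar_kind) (z : scalars R k) :
  0 < z -> 0 < scalar_re z.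
Proof. by case: k z => //= z; rewrite ltcE => /andP[]. Qed.

Section NormedMod.
Variables (R : realType) (k : scalar_kind) (V : normedModType (scalars R k)).
Implicit Types (x y : V) (a : scalars R k).

Lemma nrm_ge0 x : 0 <= nrm x.
Proof. by rewrite -(scalar_re0 _ k); apply/scalar_re_le/normr_ge0. Qed.

Lemma nrm_eq0 x : nrm x = 0 -> x = 0.
Proof.
move=> x0; apply/normr0_eq0; rewrite (ge0_of_real (normr_ge0 x)).
by rewrite -/(nrm x) x0; case: (k).
Qed.

Lemma nrmD x y : nrm (x + y) <= nrm x + nrm y.
Proof. by rewrite -scalar_reD; apply/scalar_re_le/ler_normD. Qed.

Lemma nrmZ a x : nrm (a *: x) = sabs a * nrm x.
Proof.
by rewrite /nrm normrZ (ge0_of_real (normr_ge0 a)) scalar_re_of_realM.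
Qed.

Lemma nrmB x y : nrm (x - y) = nrm (y - x).
Proof. by rewrite /nrm distrC. Qed.

Lemma nrm_cvg (u : nat -> V) (l : V) :
  (forall e : R, 0 < e -> exists n0 : nat, forall n : nat,
     (n0 <= n)%N -> nrm (u n - l) < e) -> u @ \oo --> l.
Proof.
move=> ul; apply/cvgrPdist_lt => e e0.
have [n0 n0P] := ul _ (scalar_re_gt0 e0).
exists n0 => // n /= /n0P; rewrite nrmB => ltn.
rewrite (ge0_of_real (normr_ge0 _)) (ge0_of_real (ltW e0)).
by rewrite of_real_lt.
Qed.

Lemma cvg_nrm (u : nat -> V) (l : V) : u @ \oo --> l ->
  forall e : R, 0 < e -> exists n0 : nat, forall n : nat,
     (n0 <= n)%N -> nrm (u n - l) < e.
Proof.
move=> /cvgrPdist_lt ul e e0.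
have [n0 _ n0P] := ul _ (of_real_gt0 k e0).
exists n0 => n /n0P /=; rewrite distrC (ge0_of_real (normr_ge0 _)).
by rewrite of_real_lt.
Qed.

End NormedMod.

Lemma sabs_ge0 (R : realType) (k : scalar_kind) (a : scalars R k) : 0 <= sabs a.
Proof. by rewrite -(scalar_re0 _ k); apply/scalar_re_le/normr_ge0. Qed.

Lemma sabs0 (R : realType) (k : scalar_kind) : sabs (0 : scalars R k) = 0.
Proof. by rewrite /sabs normr0 scalar_re0. Qed.

Lemma sabs_of_real (R : realType) (k : scalar_kind) (x : R) : 0 <= x ->
  sabs (of_real k x) = x.
Proof.
move=> x0; apply: (@of_real_inj _ k); rewrite -(ge0_of_real (normr_ge0 _)).
by apply: ger0_norm; case: k => //=; rewrite lecE /= eqxx.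
Qed.

Lemma scalar_cauchy_cvg (R : realType) (k : scalar_kind)
    (u : nat -> scalars R k) :
  (forall e : R, 0 < e -> exists n0 : nat, forall i j : nat,
     (n0 <= i)%N -> (n0 <= j)%N -> sabs (u i - u j) < e) ->
  exists l : scalars R k, forall e : R, 0 < e -> exists n0 : nat, forall n : nat,
     (n0 <= n)%N -> sabs (u n - l) < e.
Proof.
have real_case (v : nat -> R) :
    (forall e : R, 0 < e -> exists n0 : nat, forall i j : nat,
     (n0 <= i)%N -> (n0 <= j)%N -> `|v i - v j| < e) ->
    exists l : R, forall e : R, 0 < e -> exists n0 : nat, forall n : nat,
     (n0 <= n)%N -> `|v n - l| < e.
  move=> vC; have /cvg_ex[l vl] : cvgn v.
    apply/cauchy_cvgP/cauchy_ballP => e e0.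
    have [n0 n0P] := vC _ e0.
    exists (v @` [set n | (n0 <= n)%N], v @` [set n | (n0 <= n)%N]).
      by split; exists n0 => // n ?; exists n.
    by move=> [_ _] [/= [i ? <-] [j ? <-]]; apply: n0P.
  exists l => e e0; move/cvgrPdist_lt: vl => /(_ _ e0)[n0 _ n0P].
  by exists n0 => n /n0P; rewrite distrC.
case: k u => u; first exact: real_case.
(* The complex case reduces to the real one because the modulus dominates both parts and is
   dominated by the sum of their absolute values. *)
have sabs_def (z : scalars R ComplexScalars) :
    sabs z = Num.sqrt (complex.Re z ^+ 2 + complex.Im z ^+ 2).
  exact: (congr1 (@complex.Re R) (normc_def z)).
have re_le (z : R[i]) : `|complex.Re z| <= sabs (z : scalars R ComplexScalars).
  by rewrite sabs_def -sqrtr_sqr ler_wsqrtr // lerDl sqr_ge0.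
have im_le (z : R[i]) : `|complex.Im z| <= sabs (z : scalars R ComplexScalars).
  by rewrite sabs_def -sqrtr_sqr ler_wsqrtr // lerDr sqr_ge0.
have le_reim (z : R[i]) :
    sabs (z : scalars R ComplexScalars) <= `|complex.Re z| + `|complex.Im z|.
  rewrite sabs_def -[leRHS]ger0_norm ?addr_ge0 // -sqrtr_sqr ler_wsqrtr //.
  rewrite -(real_normK (num_real (complex.Re z))).
  rewrite -(real_normK (num_real (complex.Im z))) sqrrD addrAC lerDl.
  by rewrite mulrn_wge0 // mulr_ge0.
move=> uC.
have [|x xP] := real_case (fun n => complex.Re (u n)).
  move=> e /uC[n0 n0P]; exists n0 => i j /n0P/[apply]; apply: le_lt_trans.
  by have := re_le (u i - u j); case: (u i) (u j) => ? ? [].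
have [|y yP] := real_case (fun n => complex.Im (u n)).
  move=> e /uC[n0 n0P]; exists n0 => i j /n0P/[apply]; apply: le_lt_trans.
  by have := im_le (u i - u j); case: (u i) (u j) => ? ? [].
exists (x +i* y)%C => e e0.
have [n1 n1P] := xP (e / 2) (divr_gt0 e0 (ltr0n _ 2)).
have [n2 n2P] := yP (e / 2) (divr_gt0 e0 (ltr0n _ 2)).
exists (maxn n1 n2) => n; rewrite geq_max => /andP[/n1P lt1 /n2P lt2].
apply: le_lt_trans (le_reim _) _; rewrite [ltRHS]splitr.
by move: lt1 lt2; case: (u n) => /= ? ?; apply: ltrD.
Qed.

(* In particular the line spanned by [v] is closed. *)
Lemma scale_cvg_scalar (R : realType) (k : scalar_kind)
    (V : normedModType (scalars R k)) (a : nat -> scalars R k) (v w : V) :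
  v != 0 -> (a n *: v @[n --> \oo] --> w) ->
  exists l : scalars R k, forall y : V, a n *: y @[n --> \oo] --> l *: y.
Proof.
move=> v0 /cvg_nrm avw.
have nv0 : 0 < nrm v.
  by rewrite lt_neqAle nrm_ge0 andbT eq_sym; apply: contra_neq v0 => /nrm_eq0.
have [|l lP] := @scalar_cauchy_cvg _ _ a.
  move=> e e0; have env0 : 0 < e * nrm v / 2 by rewrite divr_gt0 ?mulr_gt0.
  have [n0 n0P] := avw _ env0.
  exists n0 => i j /n0P lti /n0P ltj.
  rewrite -(ltr_pM2r nv0) -nrmZ scalerBl -[_ - _](subrKA w).
  rewrite [ltRHS]splitr; apply: le_lt_trans (nrmD _ _) (ltrD lti _).
  by rewrite nrmB.
(* The [+ 1] below keeps the denominator positive when [y] is zero. *)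
exists l => y; apply: nrm_cvg => e e0.
have [|n0 n0P] := lP (e / (nrm y + 1)).
  by rewrite divr_gt0 // ltr_wpDl ?nrm_ge0.
exists n0 => n /n0P; rewrite ltr_pdivlMr ?ltr_wpDl ?nrm_ge0 // => lt_e.
rewrite -scalerBl nrmZ; apply: le_lt_trans lt_e.
by rewrite ler_wpM2l ?sabs_ge0 // lerDl.
Qed.

(** * Summing operators *)

Section SubmodSet.
Variables (K : pzRingType) (L : lmodType K) (V : set L).

Lemma submod_set_intro : V 0 -> (forall a u v, V u -> V v -> V (a *: u + v)) ->
  GRing.submod_closed [in V].
Proof.
move=> V0 VP; split=> [|a u v]; rewrite !inE //.
by move=> Vu Vv; apply: VP.
Qed.

Hypothesis subV : GRing.submod_closed [in V].

Lemma submod_set0 : V 0.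
Proof. by case: subV => + _; rewrite inE. Qed.

Lemma submod_setP a u v : V u -> V v -> V (a *: u + v).
Proof.
by case: subV => _ /(_ a u v) VP Vu Vv; rewrite -inE; apply: VP; rewrite inE.
Qed.

Lemma submod_setD u v : V u -> V v -> V (u + v).
Proof. by move=> Vu Vv; rewrite -(scale1r u); apply: submod_setP. Qed.

Lemma submod_setZ a u : V u -> V (a *: u).
Proof.
move=> Vu; rewrite -(addr0 (_ *: _)).
by apply: submod_setP => //; apply: submod_set0.
Qed.

Lemma submod_setB u v : V u -> V v -> V (u - v).
Proof. by move=> Vu Vv; rewrite addrC -scaleN1r; apply: submod_setP. Qed.

End SubmodSet.

Lemma multilinear_comp (K : fieldType) (m : nat) (E : 'I_m -> lmodType K)
    (L L' : lmodType K) (T : (forall j, E j) -> L) (f : L -> L') :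
  (forall a u v, f (a *: u + v) = a *: f u + f v) ->
  multilinear T -> multilinear (f \o T).
Proof. by move=> flin Tlin x j a u v; rewrite /= Tlin flin. Qed.

Lemma multilinearP (K : fieldType) (m : nat) (E : 'I_m -> lmodType K)
    (L : lmodType K) (T1 T2 : (forall j, E j) -> L) (b : K) :
  multilinear T1 -> multilinear T2 -> multilinear (b *: T1 + T2).
Proof.
move=> T1lin T2lin x j a u v.
rewrite -![(b *: T1 + T2) _]/(b *: T1 _ + T2 _) T1lin T2lin.
by rewrite !scalerDr !scalerA (mulrC a) addrACA.
Qed.

Section Summing.
Variables (R : realType) (k : scalar_kind) (m : nat).
Variables (E : 'I_m -> completeNormedModType (scalars R k)).
Variables (L : lmodType (scalars R k)) (V : set L) (q : L -> R).
Variables (Lambda : set (m.-tuple nat)) (r s : m.-tuple R).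
Hypothesis subV : GRing.submod_closed [in V].
Hypothesis qV : quasi_norm V q.
Hypothesis r1 : forall j, 1 <= tnth r j.

Lemma quasi_norm_ge0 x : V x -> 0 <= q x.
Proof. by case: qV => + _ _ _; apply. Qed.

Lemma quasi_normZ a x : V x -> q (a *: x) = sabs a * q x.
Proof. by case: qV => _ _ + _; apply. Qed.

Lemma quasi_norm0 : q 0 = 0.
Proof. by rewrite -(scale0r 0) quasi_normZ ?sabs0 ?mul0r //; apply: submod_set0. Qed.

Lemma weak_norm_ge0 (F : normedModType (scalars R k)) (p : R) N (x : nat -> F) :
  0 <= weak_norm p N x.
Proof.
rewrite /weak_norm; set A := (X in sup X).
have Age0 y : A y -> 0 <= y by move=> [phi _ <-]; apply: powR_ge0.
(* A set without supremum gets the default value 0. *)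
have [hA|/sup_out -> //] := pselect (has_sup A).
case: (hA) => -[y Ay] /ub_le_sup/(_ y Ay); apply: le_trans; exact: Age0.
Qed.

Lemma prod_weak_norm_ge0 N (x : forall j, nat -> E j) :
  0 <= \prod_(j < m) weak_norm (tnth s j) N (x j).
Proof. by apply: prodr_ge0 => j _; apply: weak_norm_ge0. Qed.

(** Common source of the stability of the class under linear combinations and under composition with
    bounded linear maps: domination of values passes to mixed norms, and the weak norms are the same
    on all sides. *)
Lemma summing_dominated (T1 T2 T : (forall j, E j) -> L) (kap : R) :
  0 <= kap -> summing E V q Lambda r s T1 -> summing E V q Lambda r s T2 ->
  (forall x, V (T x)) -> multilinear T ->
  (forall x, q (T x) <= kap * (q (T1 x) + q (T2 x))) ->
  summing E V q Lambda r s T.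
Proof.
move=> kap0 [VT1 _ [C1 [C10 C1P]]] [VT2 _ [C2 [C20 C2P]]] VT Tlin Tle.
split=> //; have [K K0 KP] := mixed_sum_le_quasi r1 ler01 kap0.
(* The [+ 1] makes the constant positive even if [K] is 0. *)
exists (K * (C1 + C2) + 1); split.
  by rewrite ltr_wpDl // mulr_ge0 // ltW // addr_gt0.
move=> N x N0 xN; set w := \prod_(j < m) _.
have w0 : 0 <= w by apply: prod_weak_norm_ge0.
pose entry (S : (forall j, E j) -> L) i : \bar R :=
  (q (patch (fun=> 0) Lambda (fun i => S (fun j => x j (tnth i j))) i))%:E.
have ge0 S i : (forall x, V (S x)) -> (0 <= entry S i)%E.
  move=> VS; rewrite lee_fin /patch.
  by case: ifP => _; rewrite ?quasi_norm0 ?quasi_norm_ge0.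
apply: le_trans (KP _ (entry T1) (entry T2) _ _ _ _) _.
- by move=> i; exact: (ge0 T i VT).
- by move=> i; exact: (ge0 T1 i VT1).
- by move=> i; exact: (ge0 T2 i VT2).
- move=> i; rewrite lee_fin /patch; case: ifP => _ //.
  by rewrite quasi_norm0 addr0 mulr0.
apply: (@le_trans _ _ (K%:E * ((C1 * w)%:E + (C2 * w)%:E))%E).
  apply: lee_wpmul2l; first by rewrite lee_fin.
  by apply: leeD; [exact: (C1P N x N0 xN)|exact: (C2P N x N0 xN)].
by rewrite -EFinD -EFinM lee_fin -mulrDl mulrA ler_wpM2r // lerDl.
Qed.

Lemma summing_comp (T : (forall j, E j) -> L) (f : L -> L) (kap : R) :
  0 <= kap -> summing E V q Lambda r s T ->
  (forall a u v, f (a *: u + v) = a *: f u + f v) ->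
  (forall y, V y -> V (f y)) -> (forall y, V y -> q (f y) <= kap * q y) ->
  summing E V q Lambda r s (f \o T).
Proof.
move=> kap0 sT flin Vf qf; have [VT Tlin _] := sT.
apply: (summing_dominated kap0 sT sT).
- by move=> x /=; apply: Vf.
- exact: multilinear_comp.
move=> x /=; apply: le_trans (qf _ (VT x)) _; rewrite ler_wpM2l // lerDl.
exact: quasi_norm_ge0.
Qed.

Lemma summing0 : summing E V q Lambda r s (0 : (forall j, E j) -> L).
Proof.
split.
- by move=> x; apply: submod_set0.
- by move=> x j a u v; rewrite -![0 (dfwith _ _ _)]/(0 : L) scaler0 addr0.
exists 1; split=> // N x N0 xN.
rewrite /mixed_norm_on /mixed_norm (_ : (fun i => _) = fun=> 0%E); last first.
  by apply/funext => i; rewrite /patch; case: ifP => _; rewrite quasi_norm0.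
by rewrite mixed_sum0 // mul1r lee_fin prod_weak_norm_ge0.
Qed.

Lemma summing_submod : GRing.submod_closed [in summing E V q Lambda r s].
Proof.
apply: submod_set_intro; first exact: summing0.
move=> a T1 T2 sT1 sT2; case: (qV) => _ _ _ [C C1 qD].
have [VT1 T1lin _] := sT1; have [VT2 T2lin _] := sT2.
have C0 : 0 <= C by apply: le_trans C1.
have a1 : 0 <= sabs a + 1 by rewrite addr_ge0 ?sabs_ge0.
apply: (summing_dominated _ sT1 sT2 (kap := C * (sabs a + 1))).
- by rewrite mulr_ge0.
- by move=> x; apply: submod_setP.
- exact: multilinearP.
move=> x; rewrite -[(a *: T1 + T2) x]/(a *: T1 x + T2 x).
apply: le_trans (qD _ _ (submod_setZ subV a (VT1 x)) (VT2 x)) _.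
rewrite quasi_normZ // -mulrA ler_wpM2l // mulrDr lerD //.
  by rewrite ler_wpM2r ?quasi_norm_ge0 // lerDl.
by rewrite ler_peMl ?quasi_norm_ge0 // lerDr sabs_ge0.
Qed.

(** Fix [i] in [Lambda] and test on the sequences with [x j] at position [tnth i j] and zeros
    elsewhere: the entry of index [i] is then [T x]. The bound [K] is independent of [T] and [C], so
    evaluation at [x] is continuous. *)
Lemma summing_const_eval (x : forall j, E j) : Lambda !=set0 ->
  exists2 K : R, 0 <= K & forall T C, (forall y, V (T y)) ->
    summing_const q Lambda r s T C -> q (T x) <= C * K.
Proof.
move=> [i Li]; pose y (j : 'I_m) (n : nat) : E j := if n == tnth i j then x j else 0.
pose N := (\max_(j < m) tnth i j).+1.
exists (\prod_(j < m) weak_norm (tnth s j) N (y j)); first exact: prod_weak_norm_ge0.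
move=> T C VT [C0 /(_ N y isT)]; rewrite -lee_fin => TP; apply: le_trans (TP _).
  rewrite /mixed_norm_on /mixed_norm; set a := (X in mixed_sum _ _ X).
  have a0 n : (0 <= a n)%E.
    rewrite /a lee_fin /patch.
    by case: ifP => _; rewrite ?quasi_norm0 ?quasi_norm_ge0.
  have := mixed_sum_ge_entry i r1 ler01 a0; rewrite poweRe1 //.
  rewrite {1}/a /patch mem_set //; congr (_%:E <= _)%E; congr (q (T _)).
  by apply: functional_extensionality_dep => j; rewrite /y eqxx.
move=> j n; rewrite /y; case: eqP => // ->; rewrite leqNgt ltnS.
by rewrite (leq_bigmax (F := fun j : 'I_m => tnth i j)).
Qed.

End Summing.

(** * Linear dimension *)

Section Hamel.
Variables (K : fieldType) (L : lmodType K) (V : set L).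
Hypothesis subV : GRing.submod_closed [in V].

Lemma lin_span_sub (B : set L) : B `<=` V -> lin_span B `<=` V.
Proof.
move=> BV _ [n [v [c [Bv ->]]]]; elim/big_ind: _ => [|x y|i _].
- exact: submod_set0.
- exact: submod_setD.
- by apply: submod_setZ => //; apply: BV.
Qed.

(** A finite family drawn from the union of a chain lies, outside [B], in a single member of the
    chain. *)
Lemma lin_indep_bigcup (B : set L) (F : set (set L)) :
  lin_indep B -> total_on F subset -> (forall A, F A -> lin_indep (B `|` A)) ->
  lin_indep (B `|` \bigcup_(A in F) A).
Proof.
move=> Bind Ftot Find n v c vinj vB.
have [[A0 FA0]|F0] := pselect (F !=set0); last first.
  apply: Bind => // i; case: (vB i) => // -[A FA _].
  by case: F0; exists A.
have [A FA vA] : exists2 A, F A & forall i, i \in enum 'I_n -> (B `|` A) (v i).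
  elim: (enum 'I_n) => [|i l [A FA vA]]; first by exists A0.
  case: (vB i) => [Bi|[A' FA' A'i]].
    by exists A => // j; rewrite inE => /orP[/eqP ->|/vA]; [left|].
  have [A'A|AA'] := Ftot _ _ FA' FA; [exists A|exists A'] => // j;
    rewrite inE => /orP[/eqP ->|/vA].
  - by right; apply: A'A.
  - by [].
  - by right.
  - by case; [left|right; apply: AA'].
by apply: Find FA _ _ _ vinj _ => i; apply: vA; rewrite mem_enum.
Qed.

(** A nonzero coefficient of [x] in a vanishing combination would allow solving for [x] in the span
    of [B]. *)
Lemma lin_indep_adjoin (B : set L) (x : L) :
  lin_indep B -> ~ lin_span B x -> lin_indep (B `|` [set x]).
Proof.
move=> Bind xB n v c vinj vB.
have [vx|] := pselect (exists i, v i = x); last first.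
  move=> vx; apply: Bind => // i; case: (vB i) => // vix.
  by case: vx; exists i.
case: vx => i0; case: n i0 v c vinj vB => [[]//|n] i0 v c vinj vB vi0.
have Bv j : B (v (lift i0 j)).
  case: (vB (lift i0 j)) => //= vj.
  by have /eqP := neq_lift i0 j; case; apply: vinj; rewrite vi0 vj.
rewrite (bigD1_ord i0) //= vi0 => sum0.
have c0 : c i0 = 0.
  apply: contrapT => /eqP ci0; apply: xB.
  exists n, (fun j => v (lift i0 j)), (fun j => - (c i0)^-1 * c (lift i0 j)).
  split=> //; under eq_bigr do rewrite -scalerA.
  rewrite -scaler_sumr -[x](scalerK ci0) -[LHS]opprK -scalerN.
  rewrite scaleNr; congr (- (_ *: _)).
  by apply/eqP; rewrite eq_sym -addr_eq0 addrC sum0.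
rewrite c0 scale0r add0r in sum0 => i.
have [j ->|->] := unliftP i0 i; last by [].
apply: (Bind n (fun j => v (lift i0 j)) (fun j => c (lift i0 j)) _ Bv sum0).
by move=> a b /vinj/lift_inj.
Qed.

(** Zorn's lemma is applied to the sets [A] added to [B], not to the supersets of [B], so that the
    empty chain, with its empty union, is admissible. *)
Lemma hamel_basis_extend (B : set L) : lin_indep B -> B `<=` V ->
  exists2 B' : set L, hamel_basis V B' & B `<=` B' /\ B' `<=` V.
Proof.
move=> Bind BV.
have [|A [[AV Aind] Amax]] :=
    @Zorn_bigcup _ [set A : set L | A `<=` V /\ lin_indep (B `|` A)].
  move=> F FP Ftot; split; first by move=> x [A /FP[AV _] /AV].
  by apply: lin_indep_bigcup => // A /FP[].
exists (B `|` A); last by split=> [x|x []]; [left|apply: BV|apply: AV].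
split=> //; apply/seteqP; split; first by apply: lin_span_sub => x [/BV|/AV].
move=> x Vx; apply: contrapT => xspan.
have Ax : ~ A x.
  move=> Ax; apply: xspan; exists 1%N, (fun=> x), (fun=> 1).
  by split=> [_|]; [right|rewrite big_ord1 scale1r].
apply: (Amax (A `|` [set x])).
  by split=> [y|/(_ x (or_intror erefl))//]; left.
split; first by move=> y [/AV//|->].
by rewrite setUA; apply: lin_indep_adjoin.
Qed.

Variables (S : Type) (alpha : set S).

Lemma card_le_dim_intro (B : set L) :
  lin_indep B -> B `<=` V -> alpha #<= B -> card_le_dim V alpha.
Proof.
move=> Bind BV alphaB; have [B' VB' [BB' _]] := hamel_basis_extend Bind BV.
by exists B' => //; apply: card_le_trans alphaB (subset_card_le BB').
Qed.

(** The basis is squeezed between [B] and [V], so counting all elements of [V] suffices for the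
    upper bound. *)
Lemma has_dim_intro (B : set L) :
  lin_indep B -> B `<=` V -> alpha #<= B -> V #<= alpha -> has_dim V alpha.
Proof.
move=> Bind BV alphaB Valpha; have [B' VB' [BB' B'V]] := hamel_basis_extend Bind BV.
exists B' => //; rewrite card_eq_le (card_le_trans (subset_card_le B'V) Valpha).
exact: card_le_trans alphaB (subset_card_le BB').
Qed.

End Hamel.

(** * Geometric series in quasi-Banach spaces *)

Section Geometric.
Variables (R : realType) (k : scalar_kind) (L : lmodType (scalars R k)).
Variables (V : set L) (q : L -> R) (C lam : R).
Hypothesis subV : GRing.submod_closed [in V].
Hypothesis qV : quasi_norm V q.
Hypothesis qD : forall x y, V x -> V y -> q (x + y) <= C * (q x + q y).
Hypothesis C1 : 1 <= C.
Hypothesis lam0 : 0 <= lam.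
Hypothesis lamC : lam * (2 * C) <= 1.

Definition geometric_sum (z : nat -> L) (n : nat) : L :=
  \sum_(i < n) of_real k lam ^+ i *: z i.

Lemma geometric_sum_mem (z : nat -> L) n :
  (forall i, V (z i)) -> V (geometric_sum z n).
Proof.
move=> Vz; rewrite /geometric_sum; elim/big_ind: _ => [|x y|i _].
- exact: submod_set0.
- exact: submod_setD.
- exact: submod_setZ.
Qed.

Lemma geometric_sum_split (z : nat -> L) n p :
  geometric_sum z (n + p)
    = geometric_sum z n +
      of_real k lam ^+ n *: geometric_sum (fun i => z (n + i)%N) p.
Proof.
rewrite /geometric_sum big_split_ord /=; congr (_ + _); rewrite scaler_sumr.
by apply: eq_bigr => i _; rewrite scalerA exprD.
Qed.

(** Peel off the first term: the rest is [lam] times a sum of the same kind, and if that sum is at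
    most [2 * C * Q] then [lamC] brings the product down to [Q]. Hence [C * (Q + Q)] reproduces the
    bound, uniformly in [n]. *)
Lemma quasi_norm_geometric_sum (z : nat -> L) (Q : R) n :
  (forall i, V (z i)) -> (forall i, q (z i) <= Q) ->
  q (geometric_sum z n) <= 2 * C * Q.
Proof.
have C0 : 0 <= C by apply: le_trans C1.
elim: n z => [|n IHn] z Vz qz;
  have Q0 : 0 <= Q by apply: le_trans (qz 0%N); apply: quasi_norm_ge0 qV _ (Vz 0%N).
  by rewrite /geometric_sum big_ord0 (quasi_norm0 subV qV) !mulr_ge0.
rewrite -add1n geometric_sum_split {1}/geometric_sum big_ord1 expr0 scale1r expr1.
set S := geometric_sum _ n.
have VS : V S by apply: geometric_sum_mem.
apply: le_trans (qD (Vz 0%N) (submod_setZ subV _ VS)) _.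
rewrite (quasi_normZ qV _ VS) sabs_of_real //.
have : lam * q S <= Q.
  apply: le_trans (ler_wpM2l lam0 (IHn _ (fun i => Vz i.+1) (fun i => qz i.+1))) _.
  by rewrite mulrA ler_piMl.
move=> /(lerD (qz 0%N))/(ler_wpM2l C0)/le_trans; apply.
by rewrite -mulr2n -[Q *+ 2]mulr_natl mulrA (mulrC C).
Qed.

Hypothesis cV : quasi_complete V q.

(** The block from [i] to [j] is [lam ^+ i] times a bounded sum, hence the Cauchy property. The
    extra factor [C] is the price of passing to the limit, as [q] need not be continuous. *)
Lemma geometric_sum_cvg (z : nat -> L) (Q : R) :
  (forall i, V (z i)) -> (forall i, q (z i) <= Q) ->
  exists l : L, [/\ V l, q l <= C * (2 * C * Q) &
    forall e : R, 0 < e -> exists n0 : nat, forall i : nat,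
      (n0 <= i)%N -> q (geometric_sum z i - l) < e].
Proof.
move=> Vz qz; have C0 : 0 <= C by apply: le_trans C1.
have Q0 : 0 <= Q by apply: le_trans (qz 0%N); apply: quasi_norm_ge0 qV _ (Vz 0%N).
have qN x : V x -> q (- x) = q x.
  move=> Vx; rewrite -scaleN1r (quasi_normZ qV _ Vx) /sabs normrN1.
  by rewrite -[RHS]mul1r; congr (_ * _); case: (k).
have VS n : V (geometric_sum z n) by apply: geometric_sum_mem.
(* By [lamC] and [C1], [lam] is at most 1/2. *)
have lam1 : `|lam| < 1.
  rewrite ger0_norm //; apply: contra_le_lt lamC => lam_ge1.
  by apply: lt_le_trans (ler_pM _ _ lam_ge1 (ler_pM _ _ (lexx 2) C1)) => //; lra.
have sabsX n : sabs (of_real k lam ^+ n) = lam ^+ n.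
  by rewrite -of_realX sabs_of_real // exprn_ge0.
have [e e0|l Vl lP] := cV VS.
  have /cvgrPdist_lt/(_ _ e0)[n0 _ n0P] :
      lam ^+ n * (2 * C * Q) @[n --> \oo] --> (0 : R).
    by rewrite -[X in _ --> X](mul0r (2 * C * Q)); apply: cvgMl; apply: cvg_expr.
  have le_case i j : (n0 <= i)%N -> (i <= j)%N ->
      q (geometric_sum z j - geometric_sum z i) < e.
    move=> /n0P lte leij; rewrite -(subnKC leij) geometric_sum_split addrC addKr.
    have VT : V (geometric_sum (fun p => z (i + p)%N) (j - i)).
      exact: geometric_sum_mem.
    rewrite (quasi_normZ qV _ VT) sabsX.
    have qT := quasi_norm_geometric_sum (j - i)
      (fun p => Vz (i + p)%N) (fun p => qz (i + p)%N).
    apply: le_lt_trans (ler_wpM2l (exprn_ge0 _ lam0) qT) _.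
    by apply: le_lt_trans lte; rewrite sub0r normrN ler_norm.
  exists n0 => i j ni nj; have [leij|/ltnW leji] := leqP i j; last exact: le_case.
  by rewrite -qN ?opprB; [apply: le_case|apply: submod_setB].
exists l; split=> //; apply/ler_addgt0Pr => e e0.
have [n0 /(_ n0 (leqnn _)) n0P] := lP (e / C) (divr_gt0 e0 (lt_le_trans ltr01 C1)).
rewrite -[l](subrK (geometric_sum z n0)).
apply: le_trans (qD (submod_setB subV Vl (VS n0)) (VS n0)) _.
rewrite -qN ?opprB; last exact: submod_setB.
have := quasi_norm_geometric_sum n0 Vz qz => qS.
apply: le_trans (ler_wpM2l C0 (lerD (ltW n0P) qS)) _.
by rewrite mulrDr [C * (e / C)]mulrC divfK ?gt_eqF ?(lt_le_trans ltr01) // addrC.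
Qed.

End Geometric.

(** * Spreading sequences *)

(* The bijection [(k, i) -> p] with [p + 1 = 2 ^ k * (2 * i + 1)]. *)
Definition dyad (k i : nat) : nat := (2 ^ k * i.*2.+1).-1.
Definition dyad_class (p : nat) : nat := logn 2 p.+1.
Definition dyad_rank (p : nat) : nat := (p.+1 %/ 2 ^ logn 2 p.+1)./2.

Lemma dyadS k i : (dyad k i).+1 = (2 ^ k * i.*2.+1)%N.
Proof. by rewrite prednK // muln_gt0 expn_gt0. Qed.

Lemma dyadK k i : dyad_class (dyad k i) = k.
Proof.
rewrite /dyad_class dyadS lognM ?expn_gt0 // pfactorK //.
by rewrite lognE /= dvdn2 /= odd_double addn0.
Qed.

Lemma dyad_rankK k i : dyad_rank (dyad k i) = i.
Proof.
have := dyadK k i; rewrite /dyad_rank /dyad_class => ->.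
by rewrite dyadS mulKn ?expn_gt0 // -addn1 addn1 /= uphalf_double.
Qed.

Lemma dyad_classK p : dyad (dyad_class p) (dyad_rank p) = p.
Proof.
apply: succn_inj; rewrite dyadS /dyad_rank /dyad_class.
have [n n2] := pfactor_coprime (isT : prime 2) (ltn0Sn p).
move: (logn 2 p.+1) => e ->; rewrite mulnK ?expn_gt0 // mulnC.
by rewrite -[in RHS](odd_double_half n) -coprime2n n2.
Qed.

Lemma dyad_mono k : {homo dyad k : i j / (i < j)%N}.
Proof.
move=> i j ltij; rewrite -ltnS !dyadS ltn_pmul2l ?expn_gt0 //.
by rewrite ltnS ltn_double.
Qed.

Section Mix.
Variables (R : realType) (k : scalar_kind).
Variables (X : completeNormedModType (scalars R k)).
Implicit Types (eps : bool) (x y : nat -> X) (b : nat -> scalars R k).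

Definition restrict eps y : nat -> X := fun j => if odd j == eps then y j else 0.

(** For fixed [c] this enumerates increasingly the set N_c; halving such a position gives its dyadic
    code. *)
Definition slot eps (c i : nat) : nat := (dyad c i).*2 + ~~ eps.

Definition spread eps c y : nat -> X := fun j =>
  if (odd j != eps) && (dyad_class j./2 == c) then y (dyad_rank j./2) else 0.

(** The formal series [b 0 *: y] plus the sum over [c] of [b c.+1 *: spread eps c y]. At each
    position at most one of the spreads is nonzero, so it makes sense for every [b], whether or not
    it converges for [q]. *)
Definition mix eps b y : nat -> X := fun j =>
  b 0%N *: y j +
  (if odd j == eps then 0 else b (dyad_class j./2).+1 *: y (dyad_rank j./2)).

Lemma odd_slot eps c i : odd (slot eps c i) = ~~ eps.
Proof. by rewrite /slot oddD odd_double; case: eps. Qed.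

Lemma slot_half eps c i : (slot eps c i)./2 = dyad c i.
Proof. by rewrite /slot addnC half_bit_double. Qed.

Lemma restrictP eps a x y :
  restrict eps (a *: x + y) = a *: restrict eps x + restrict eps y.
Proof.
apply/funext => j; rewrite /restrict; rewrite -![(_ + _) j]/(_ j + _ j).
rewrite -![(_ *: _) j]/(_ *: _ j) /=; case: ifP => // _.
by rewrite scaler0 addr0.
Qed.

Lemma mixP eps b a x y : mix eps b (a *: x + y) = a *: mix eps b x + mix eps b y.
Proof.
apply/funext => j.
rewrite /mix -![(_ + _) _]/(_ _ + _ _) -![(_ *: _) _]/(_ *: _ _) /=.
case: ifP => _.
  by rewrite !addr0 scalerDr !scalerA mulrC.
rewrite !scalerDr !scalerA ![a * _]mulrC.
by rewrite addrACA.
Qed.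

Lemma mix_scalarP eps b b' a y :
  mix eps (fun i => a * b i + b' i) y = a *: mix eps b y + mix eps b' y.
Proof.
apply/funext => j; rewrite /mix -![(_ + _) _]/(_ _ + _ _) -![(_ *: _) _]/(_ *: _ _).
rewrite /= !scalerDl -!scalerA; case: ifP => _; first by rewrite !addr0.
by rewrite !scalerDr addrACA.
Qed.

Lemma mix_slot eps b y c i :
  mix eps b y (slot eps c i) = b 0%N *: y (slot eps c i) + b c.+1 *: y i.
Proof.
by rewrite /mix odd_slot slot_half dyadK dyad_rankK; case: eps.
Qed.

Lemma mix_fix eps b y j : odd j = eps -> mix eps b y j = b 0%N *: y j.
Proof. by move=> oddj; rewrite /mix oddj eqxx addr0. Qed.

Lemma restrict_mix eps b y : restrict eps (mix eps b y) = b 0%N *: restrict eps y.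
Proof.
apply/funext => j; rewrite -[(_ *: _) _]/(_ *: _ _) /restrict.
by case: eqP => [/mix_fix|_]; rewrite ?scaler0.
Qed.

Lemma restrictD y : y = restrict true y + restrict false y.
Proof.
apply/funext => j; rewrite -[(_ + _) _]/(_ _ + _ _) /restrict.
by case: (odd j); rewrite ?addr0 ?add0r.
Qed.

Section Bounds.
Variables (V : set (nat -> X)) (q : (nat -> X) -> R).
Hypothesis seqV : standard_sequence_space V q.

Lemma subseq_mem x (n : nat -> nat) : V x -> {homo n : i j / (i < j)%N} ->
  V (x \o n) /\ q (x \o n) <= q x.
Proof. by case: seqV => _ _ _ + _; apply. Qed.

Lemma stretch_mem x y (n : nat -> nat) : V x -> {homo n : i j / (i < j)%N} ->
  (forall i, y (n i) = x i) -> (forall j, ~ range n j -> y j = 0) ->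
  V y /\ q y <= q x.
Proof. by case: seqV => _ _ _ _; apply. Qed.

Lemma slot_mono eps c : {homo slot eps c : i j / (i < j)%N}.
Proof. by move=> i j /(dyad_mono c); rewrite ltn_add2r ltn_double. Qed.

(** Condition (ii) extracts the entries of parity [eps], and condition (iii) puts them back in place
    with zeros between them. *)
Lemma restrict_mem eps y : V y -> V (restrict eps y) /\ q (restrict eps y) <= q y.
Proof.
move=> Vy; pose n i := (i.*2 + eps)%N.
have nmono : {homo n : i j / (i < j)%N} by move=> i j; rewrite ltn_add2r ltn_double.
have [Vyn qyn] := subseq_mem Vy nmono.
have [|j jn|Vr qr] := @stretch_mem (y \o n) (restrict eps y) n Vyn nmono.
- by move=> i; rewrite /restrict /n oddD odd_double oddb eqxx.
- rewrite /restrict; case: eqP => // oddj; case: jn; exists j./2 => //.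
  by rewrite /n -oddj addnC odd_double_half.
by split=> //; apply: le_trans qr qyn.
Qed.

Lemma spread_mem eps c y : V y -> V (spread eps c y) /\ q (spread eps c y) <= q y.
Proof.
move=> Vy; apply: (stretch_mem Vy (@slot_mono eps c)) => [i|j jn].
  by rewrite /spread odd_slot slot_half dyadK dyad_rankK eqxx; case: eps.
rewrite /spread; case: ifP => // /andP[oddj /eqP jc]; case: jn.
exists (dyad_rank j./2) => //; rewrite /slot -jc dyad_classK.
have -> : ~~ eps = odd j by case: (odd j) eps oddj => [] [].
by rewrite addnC odd_double_half.
Qed.

End Bounds.
End Mix.

(** * The space of mixed operators *)

(** The coefficient of [T] itself is 0, so the mix is the series of the $\lambda^c T_c$. *)
Definition geometric_coef (R : realType) (k : scalar_kind) (lam : R) (i : nat) :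
    scalars R k :=
  if i is c.+1 then of_real k lam ^+ c else 0.

Section Spaceable.
Variables (R : realType) (k : scalar_kind).
Variables (X : completeNormedModType (scalars R k)).
Variables (V : set (nat -> X)) (q : (nat -> X) -> R).
Hypothesis seqV : standard_sequence_space V q.

Lemma sequence_submod : GRing.submod_closed [in V].
Proof. by case: seqV => -[]. Qed.

Lemma sequence_quasi_norm : quasi_norm V q.
Proof. by case: seqV => -[]. Qed.

Let subV := sequence_submod.
Let qV := sequence_quasi_norm.

(** Coordinates are continuous by condition (i). This identifies a limit for [q] with a series
    computed coordinatewise. *)
Lemma quasi_norm_coord_small (x : nat -> X) (y : X) j :
  (forall e : R, 0 < e -> exists z : nat -> X,
     [/\ V (z - x), q (z - x) < e & z j = y]) -> x j = y.
Proof.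
case: seqV => _ _ [C C0 Cq] _ _ small.
apply/eqP; rewrite eq_sym -subr_eq0; apply/eqP/nrm_eq0/eqP.
rewrite eq_le nrm_ge0 andbT; apply/ler_addgt0Pr => e e0; rewrite add0r.
have [z [Vzx qzx <-]] := small (e / C) (divr_gt0 e0 C0).
apply: le_trans (Cq _ Vzx j) _; apply: le_trans (ler_wpM2l (ltW C0) (ltW qzx)) _.
by rewrite mulrC divfK ?gt_eqF.
Qed.

Lemma geometric_sum_spread eps lam (y : nat -> X) j n : (dyad_class j./2 < n)%N ->
  geometric_sum lam (fun c => spread eps c y) n j
    = mix eps (geometric_coef k lam) y j.
Proof.
move=> ltn; rewrite /geometric_sum fct_sumE /mix scale0r add0r.
under eq_bigr do rewrite -[(_ *: _) _]/(_ *: _ _).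
case: eqP => [oddj|/eqP oddj].
  by rewrite big1 // => i _; rewrite /spread oddj eqxx scaler0.
rewrite (bigD1 (Ordinal ltn)) //= big1 ?addr0; first by rewrite /spread oddj eqxx.
move=> i; rewrite -val_eqE /= /spread => /negbTE neq.
by rewrite [_ == val i]eq_sym neq andbF scaler0.
Qed.

(** For [lam] up to [(2 * C)^-1] the geometric series of the spreads converges in [V]. Each
    coordinate of its partial sums is eventually that of the mix, so the mix is the limit and
    inherits its bound. *)
Lemma mix_geometric_bounded : exists delta kap : R, [/\ 0 < delta, 0 <= kap &
  forall eps lam (y : nat -> X), 0 <= lam <= delta -> V y ->
    V (mix eps (geometric_coef k lam) y) /\
    q (mix eps (geometric_coef k lam) y) <= kap * q y].
Proof.
have [_ _ _ [C C1 qD]] := qV; have C0 : 0 < C by apply: lt_le_trans C1.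
have [[_ _ cV _] _ _ _ _] := seqV.
exists (2 * C)^-1, (C * (2 * C)); split.
- by rewrite invr_gt0 mulr_gt0.
- by rewrite !mulr_ge0 // ltW.
move=> eps lam y /andP[lam0].
rewrite -[leRHS]div1r ler_pdivlMr ?mulr_gt0 // => lamC Vy.
have zP c := spread_mem seqV eps c Vy.
have [l [Vl ql lP]] := geometric_sum_cvg subV qV qD C1 lam0 lamC cV
  (fun c => (zP c).1) (fun c => (zP c).2).
suff -> : mix eps (geometric_coef k lam) y = l by rewrite -mulrA.
apply/funext => j; apply/esym/quasi_norm_coord_small => e /lP[n0 n0P].
exists (geometric_sum lam (fun c => spread eps c y) (n0 + (dyad_class j./2).+1)).
split; last by rewrite geometric_sum_spread // addnS ltnS leq_addl.
  apply: submod_setB => //; apply: geometric_sum_mem => // c; exact: (zP c).1.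
by apply: n0P; rewrite leq_addr.
Qed.

Variables (m : nat) (E : 'I_m -> completeNormedModType (scalars R k)).
Variables (r s : m.-tuple R) (Lambda : set (m.-tuple nat)).
Hypothesis r1 : forall j, 1 <= tnth r j.
Hypothesis Lambda0 : Lambda !=set0.
Variable T : (forall j, E j) -> nat -> X.
Hypothesis sT : summing E V q Lambda r s T.
Variables (eps : bool) (x0 : forall j, E j) (j0 : nat).
Hypothesis oddj0 : odd j0 = eps.
Hypothesis Tx0 : T x0 j0 != 0.

Lemma restrict_summing (S : (forall j, E j) -> nat -> X) eps' :
  summing E V q Lambda r s S ->
  summing E V q Lambda r s (restrict eps' \o S).
Proof.
move=> sS; apply: (summing_comp subV qV r1 ler01 sS).
- exact: restrictP.
- by move=> y /(restrict_mem seqV eps')[].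
- by move=> y /(restrict_mem seqV eps')[_]; rewrite mul1r.
Qed.

(** No growth condition is put on [b]: the summing property of the mix is required directly, so a
    limit only has to be recognized as a mix. *)
Definition mix_space : set ((forall j, E j) -> nat -> X) :=
  [set S | summing E V q Lambda r s S /\ exists b, S = mix eps b \o T].

Lemma mix_space_submod : GRing.submod_closed [in mix_space].
Proof.
have subS := summing_submod E Lambda s subV qV r1.
apply: submod_set_intro.
  split; first exact: (submod_set0 subS).
  exists (fun=> 0); apply/funext => x; apply/funext => j.
  by rewrite /= /mix !scale0r if_same addr0.
move=> a S S' [sS [b Sb]] [sS' [b' Sb']]; split; first exact: submod_setP.
exists (fun i => a * b i + b' i); rewrite Sb Sb'; apply/funext => x.
by rewrite [RHS]/= mix_scalarP.
Qed.

Lemma mem_mix_space : mix_space T.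
Proof.
split=> //; exists (fun i => (i == 0%N)%:R); apply/funext => x; apply/funext => j.
by rewrite /= /mix scale1r scale0r if_same addr0.
Qed.

Lemma mix_space_card_le : mix_space #<= [set: R].
Proof.
apply: card_le_trans (scalar_seq_card_le R k).
apply: card_le_trans (card_image_le (fun b => mix eps b \o T) setT).
by apply: subset_card_le => _ [_ [b ->]]; exists b.
Qed.

Let geometric lam := mix eps (geometric_coef k lam) \o T.

Lemma geometric_eval lam c :
  geometric lam x0 (slot eps c j0) = of_real k lam ^+ c *: T x0 j0.
Proof. by rewrite /geometric /= mix_slot scale0r add0r. Qed.

(** The copy of [T x0 j0] in N_1 carries the factor [lam] itself. *)
Lemma of_real_geometric_inj lam lam' : geometric lam = geometric lam' -> lam = lam'.
Proof.
move=> /(congr1 (fun S => S x0 (slot eps 1 j0))); rewrite !geometric_eval !expr1.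
move=> /eqP; rewrite -subr_eq0 -scalerBl scaler_eq0 (negbTE Tx0) orbF subr_eq0.
by move=> /eqP/of_real_inj.
Qed.

(* Evaluating a linear relation at the copies of [T x0 j0] yields a Vandermonde
   system, tested here against Lagrange polynomials. *)
Lemma geometric_lin_indep (D : set R) :
  lin_indep [set geometric lam | lam in D].
Proof.
move=> n v c vinj vD sum0 i.
have {vD}/choice[lam lamP] : forall i, exists lam, geometric lam = v i.
  by move=> i'; have [lam _ <-] := vD i'; exists lam.
have moment p : \sum_(j < n) c j * of_real k (lam j) ^+ p = 0.
  have /(congr1 (fun S => S x0 (slot eps p j0))) := sum0.
  rewrite !fct_sumE -[RHS]/(0 : X) => sum_p.
  have : (\sum_(j < n) c j * of_real k (lam j) ^+ p) *: T x0 j0 = 0.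
    rewrite -[RHS]sum_p scaler_suml; apply: eq_bigr => j _.
    by rewrite -lamP -scalerA -geometric_eval.
  by move/eqP; rewrite scaler_eq0 (negbTE Tx0) orbF => /eqP.
have eval (p : {poly scalars R k}) : \sum_(j < n) c j * p.[of_real k (lam j)] = 0.
  under eq_bigr do rewrite horner_coef mulr_sumr.
  rewrite exchange_big big1 //= => d _.
  under eq_bigr do rewrite mulrCA.
  by rewrite -mulr_sumr moment mulr0.
have := eval (\prod_(j < n | j != i) ('X - (of_real k (lam j))%:P)).
rewrite (bigD1 i) //= [X in _ + X]big1 ?addr0 => [/eqP|j ji].
  rewrite mulf_eq0 => /orP[/eqP//|]; rewrite horner_prod => /prodf_eq0[j ji].
  rewrite hornerXsubC subr_eq0 => /eqP/of_real_inj lamij.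
  by case/eqP: ji; apply: vinj; rewrite -!lamP lamij.
rewrite horner_prod (bigD1 j) //= hornerXsubC subrr mul0r mulr0 //.
Qed.

Lemma exists_geometric_set : exists D : set R,
  [set geometric lam | lam in D] `<=` mix_space /\
  [set: R] #<= [set geometric lam | lam in D].
Proof.
have [delta [kap [delta0 kap0 bounded]]] := mix_geometric_bounded.
exists [set lam | 0 <= lam <= delta]; split.
  move=> _ [lam lamD <-]; split; last by exists (geometric_coef k lam).
  apply: (summing_comp subV qV r1 kap0 sT).
  - exact: mixP.
  - by move=> y /(bounded eps lam y lamD)[].
  - by move=> y /(bounded eps lam y lamD)[].
(* The map sending [x] to [delta / (1 + expR x)] injects the whole line into the interval of
   admissible [lam]. *)
have e1 (x : R) : 0 < 1 + expR x by rewrite addr_gt0 ?expR_gt0.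
apply: (@injective_card_le _ _ _ _ (fun x => geometric (delta / (1 + expR x)))).
  move=> x y /of_real_geometric_inj/(mulfI (lt0r_neq0 delta0))/invr_inj.
  by move=> /addrI/expR_inj.
move=> x _; exists (delta / (1 + expR x)) => //=.
rewrite divr_ge0 ?(ltW delta0) ?(ltW (e1 x)) //= ler_pdivrMr //.
by rewrite ler_peMr ?(ltW delta0) // lerDl expR_ge0.
Qed.

(** The norm is an infimum, so an admissible constant still below [d] is picked and fed to
    [summing_const_eval]; condition (i) then controls all coordinates at once. *)
Lemma summing_norm_eval_lt (x : forall j, E j) (e : R) : 0 < e ->
  exists2 d : R, 0 < d & forall S, summing E V q Lambda r s S ->
    summing_norm q Lambda r s S < d -> forall j, nrm (S x j) < e.
Proof.
move=> e0; have [K K0 KP] := summing_const_eval s subV qV r1 x Lambda0.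
case: seqV => _ _ [C C0 Cq] _ _.
have CK0 : 0 < C * (K + 1) by rewrite mulr_gt0 // ltr_wpDl.
exists (e / (C * (K + 1))) => [|S [VS _ [B SB]] norm_lt j]; first exact: divr_gt0.
have [||B' SB'] := @inf_adherent _ [set C | summing_const q Lambda r s S C]
    (e / (C * (K + 1)) - summing_norm q Lambda r s S).
- by rewrite subr_gt0.
- by split; [exists B|exists 0 => ? -[/ltW]].
rewrite addrC subrK => B'lt; apply: le_lt_trans (Cq _ (VS x) j) _.
apply: le_lt_trans (ler_wpM2l (ltW C0) (KP _ _ VS SB')) _.
move: B'lt; rewrite ltr_pdivlMr //; apply: le_lt_trans.
rewrite mulrCA; apply: ler_wpM2l; first by case: SB' => /ltW.
by rewrite ler_wpM2l ?ltW // ltrDl.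
Qed.

Lemma mix_space_closed :
  quasi_closed (summing E V q Lambda r s) (summing_norm q Lambda r s) mix_space.
Proof.
have subS := summing_submod E Lambda s subV qV r1.
split=> [S []//|]; split=> [S []//|S [sS notmix]].
apply: contrapT => /forall2NP noball.
(* If no ball around [S] avoids W, there is a sequence in W that converges to [S]. *)
have /choice[u uP] n : exists S', mix_space S' /\
    summing_norm q Lambda r s (S' - S) < n.+1%:R^-1.
  have [/negP|] := noball n.+1%:R^-1; first by rewrite invr_gt0 ltr0n.
  move=> /existsNP[S' /not_implyP[sS' /not_implyP[S'lt notin]]].
  by exists S'; split=> //; apply: contrapT => notmix'; apply: notin.
have u_cvg x j : u n x j @[n --> \oo] --> S x j.
  apply: nrm_cvg => e e0; have [d d0 dP] := summing_norm_eval_lt x e0.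
  have [n0 n0P] : exists n0 : nat, n0.+1%:R^-1 < d.
    exists (Num.truncn d^-1); rewrite invf_plt ?posrE ?ltr0n //.
    by rewrite truncnS_gt.
  exists n0 => n len; have [[sun _] normlt] := uP n.
  apply: (dP (u n - S)); first by apply: submod_setB.
  apply: lt_trans normlt (le_lt_trans _ n0P).
  by rewrite lef_pV2 ?posrE ?ltr0n // ler_nat.
have /choice[b bP] n : exists b, u n = mix eps b \o T by case: (uP n) => -[_].
(* At [j0], which has parity [eps], only the coefficient of index 0 contributes. *)
have b0_cvg : b n 0%N *: T x0 j0 @[n --> \oo] --> S x0 j0.
  rewrite (_ : (fun n => _) = (fun n => u n x0 j0)) //.
  by apply/funext => n; rewrite bP /= mix_fix.
have [l0 l0P] := scale_cvg_scalar Tx0 b0_cvg.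
(* The contribution of index 0 is now known to converge at every position; subtracting it isolates
   the coefficient of index [c.+1]. *)
have bS_cvg c : b n c.+1 *: T x0 j0 @[n --> \oo] -->
    S x0 (slot eps c j0) - l0 *: T x0 (slot eps c j0).
  rewrite (_ : (fun n => _) = (fun n => u n x0 (slot eps c j0)
    - b n 0%N *: T x0 (slot eps c j0))); first exact: cvgB.
  by apply/funext => n; rewrite bP /= mix_slot addrC addKr.
have /choice[l lP] i : exists l, forall y : X, b n i *: y @[n --> \oo] --> l *: y.
  by case: i => [|c]; [exists l0|apply: scale_cvg_scalar Tx0 (bS_cvg c)].
(* Each coordinate of a mix involves at most two coefficients, so it converges to the mix with the
   limit coefficients. *)
apply: notmix; split=> //; exists l; apply/funext => x; apply/funext => j.
apply: (cvg_unique _ (u_cvg x j)); first exact: norm_hausdorff.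
rewrite (_ : (fun n => _) = (fun n => mix eps (b n) (T x) j)); last first.
  by apply/funext => n; rewrite bP.
apply: cvgD; first exact: lP.
by case: ifP => _; [apply: cvg_cst|apply: lP].
Qed.

End Spaceable.

(** * Mixed operators and the second summing class *)

Section Dichotomy.
Variables (R : realType) (k : scalar_kind).
Variables (X : completeNormedModType (scalars R k)).
Variables (V : set (nat -> X)) (q : (nat -> X) -> R).
Hypothesis seqV : standard_sequence_space V q.
Variables (m : nat) (E : 'I_m -> completeNormedModType (scalars R k)).
Variables (t u : m.-tuple R) (Gamma : set (m.-tuple nat)).
Hypothesis t1 : forall j, 1 <= tnth t j.

Let subV := sequence_submod seqV.
Let qV := sequence_quasi_norm seqV.
Let subG := summing_submod E Gamma u subV qV t1.

Lemma exists_nonsumming_part (T : (forall j, E j) -> nat -> X) :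
  ~ summing E V q Gamma t u T ->
  exists eps, ~ summing E V q Gamma t u (restrict eps \o T).
Proof.
move=> nT; apply: contrapT => /forallNP sT; apply: nT.
have -> : T = (restrict true \o T) + (restrict false \o T).
  by apply/funext => x; exact: restrictD.
by apply: submod_setD => //; apply: contrapT; apply: sT.
Qed.

(** The zero operator is summing, so the restriction is nonzero; the entry found is the one whose
    copies reveal the coefficients. *)
Lemma exists_nonzero_entry (T : (forall j, E j) -> nat -> X) eps :
  ~ summing E V q Gamma t u (restrict eps \o T) ->
  exists x j, odd j = eps /\ T x j != 0.
Proof.
move=> nT; apply: contrapT => noentry; apply: nT.
rewrite (_ : _ \o _ = 0); first exact: (submod_set0 subG).
apply/funext => x; apply/funext => j; rewrite /= /restrict.
case: eqP => // oddj; apply: contrapT => /eqP Txj.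
by apply: noentry; exists x, j.
Qed.

Lemma mix_nonsumming (T : (forall j, E j) -> nat -> X) eps b :
  ~ summing E V q Gamma t u (restrict eps \o T) ->
  summing E V q Gamma t u (mix eps b \o T) -> mix eps b \o T = 0.
Proof.
move=> nrT sS; have scale_nT (a : scalars R k) S :
    a != 0 -> summing E V q Gamma t u (a *: S) -> summing E V q Gamma t u S.
  by move=> a0 /(submod_setZ subG a^-1); rewrite scalerK.
(* Restriction to parity [eps] erases every spread and leaves [b 0] times the part of [T] that is
   not summing. *)
have b0 : b 0%N = 0.
  apply: contrapT => /eqP b0; apply: nrT; apply: (scale_nT _ _ b0).
  rewrite (_ : _ *: _ = restrict eps \o (mix eps b \o T)).
    exact: restrict_summing.
  by apply/funext => x; rewrite /= restrict_mix.
suff bS c : b c.+1 = 0.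
  apply/funext => x; apply/funext => j; rewrite /= /mix b0 scale0r add0r.
  by rewrite bS scale0r if_same.
(* With [b 0] gone, the subsequence along [slot eps c] is [b c.+1] times the whole of [T]; were it
   summing, so would be the restriction of [T]. *)
apply: contrapT => /eqP bc; apply: nrT; apply: restrict_summing => //.
apply: (scale_nT _ _ bc).
rewrite (_ : _ *: _ = (fun y => y \o slot eps c) \o (mix eps b \o T)).
  apply: (summing_comp subV qV t1 ler01 sS) => //.
  - by move=> y /(subseq_mem seqV)/(_ (@slot_mono eps c))[].
  - by move=> y /(subseq_mem seqV)/(_ (@slot_mono eps c))[_]; rewrite mul1r.
apply/funext => x; apply/funext => i.
by rewrite /= mix_slot b0 scale0r add0r.
Qed.

End Dichotomy.

Theorem theorem3p1 (R : realType) (k : scalar_kind) (m : nat)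
    (E : 'I_m -> completeNormedModType (scalars R k))
    (X : completeNormedModType (scalars R k))
    (calE : set (nat -> X)) (q : (nat -> X) -> R)
    (r s t u : m.-tuple R) (Lambda Gamma : set (m.-tuple nat)) :
  (0 < m)%N ->
  standard_sequence_space calE q ->
  (forall j, 1 <= tnth r j) -> (forall j, 1 <= tnth s j) ->
  (forall j, 1 <= tnth t j) -> (forall j, 1 <= tnth u j) ->
  Lambda !=set0 -> Lambda `<=` Gamma ->
  summing E calE q Lambda r s `\` summing E calE q Gamma t u = set0 \/
  pointwise_spaceable
    (summing E calE q Lambda r s) (summing_norm q Lambda r s) [set: R]
    (summing E calE q Lambda r s `\` summing E calE q Gamma t u).
Proof.
move=> _ seqE r1 _ t1 _ Lambda0 _.
have [[T0 AT0]|/set0P/negP/negPn/eqP] := pselect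
  (summing E calE q Lambda r s `\` summing E calE q Gamma t u !=set0);
  last by left.
right; have subS := summing_submod E Lambda s (sequence_submod seqE)
  (sequence_quasi_norm seqE) r1.
(* Parity and reference entry depend on the operator, so W is built anew for each point. *)
have AP T : (summing E calE q Lambda r s `\` summing E calE q Gamma t u) T ->
    exists eps x j, [/\ odd j = eps, T x j != 0 &
      ~ summing E calE q Gamma t u (restrict eps \o T)].
  move=> [_ /(exists_nonsumming_part seqE t1)[eps nT]].
  have [x [j [oddj Txj]]] := exists_nonzero_entry seqE t1 nT.
  by exists eps, x, j.
split; [|by move=> S []|].
  (* One operator of the difference already provides continuum many independent members of the
     ambient space. *)
  have [eps [x [j [oddj Txj _]]]] := AP _ AT0.
  have [D [DW cardD]] := exists_geometric_set seqE r1 AT0.1 eps Txj.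
  have indD := geometric_lin_indep Txj (eps := eps) (D := D).
  by apply: (card_le_dim_intro subS indD) => // S /DW[].
move=> T AT; have [eps [x [j [oddj Txj nT]]]] := AP _ AT.
exists (mix_space calE q r s Lambda T eps); split.
- exact: mix_space_submod.
- exact: (mix_space_closed seqE s r1 Lambda0 oddj Txj).
- have [D [DW cardD]] := exists_geometric_set seqE r1 AT.1 eps Txj.
  have indD := geometric_lin_indep Txj (eps := eps) (D := D).
  apply: (has_dim_intro _ indD DW) => //; last exact: mix_space_card_le.
  exact: mix_space_submod.
- by apply: mem_mix_space => //; apply: AT.1.
move=> S [sS [b Sb]]; have [sG|nG] := pselect (summing E calE q Gamma t u S).
  right; rewrite Sb; apply: (mix_nonsumming seqE t1 nT); rewrite -Sb; exact: sG.
left; exact: (conj sS nG).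
Qed.
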